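(* Let $P$ be the transition matrix of a finite irreducible Markov chain with states $\{1,\dots,m\}$, stationary probability vector $\boldsymbol{\pi}^T=(\pi_1,\dots,\pi_m)$ and mean first passage times $\{m_{ij}\}$. Let $G=[g_{ij}]$ be the Moore-Penrose g-inverse of $I-P$, so that $G=G(\boldsymbol{\pi}/\boldsymbol{\pi}^T\boldsymbol{\pi},\,\boldsymbol{e}/m,\,-1)$. With $\eta_j=\frac{1}{m}\sum_{k\neq j}m_{kj}$ and $s=\sum_{k=1}^m\pi_k^2$, $$g_{ij}=\begin{cases}\left(\eta_j-m_{ij}+\frac{1}{s}\sum_{k\neq i}\pi_k^2m_{ik}-\frac{1}{s}\sum_{k=1}^m\pi_k^2\eta_k\right)\pi_j, & i\neq j,\\[4pt] \left(\eta_j+\frac{1}{s}\sum_{k\neq j}\pi_k^2m_{jk}-\frac{1}{s}\sum_{k=1}^m\pi_k^2\eta_k\right)\pi_j, & i=j.\end{cases}$$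
   Context: $\boldsymbol{e}$ is the all-ones column vector; $\boldsymbol{\pi}^T$ is the unique stationary probability vector ($\boldsymbol{\pi}^TP=\boldsymbol{\pi}^T$, $\boldsymbol{\pi}^T\boldsymbol{e}=1$). $m_{ij}=E[T_{ij}\mid X_0=i]$, where $T_{ij}=\min\{n\ge 1: X_n=j\}$ given $X_0=i$ (first return when $i=j$); these are finite and $m_{jj}=1/\pi_j$. The Moore-Penrose g-inverse of $A=I-P$ is the unique real matrix $X$ with $AXA=A$, $XAX=X$, $(AX)^T=AX$, $(XA)^T=XA$. A g-inverse of $I-P$ is a real $m\times m$ matrix $G$ with $(I-P)G(I-P)=I-P$. Parametric form (known fact): every g-inverse $G$ of $I-P$ can be uniquely written as $G=[I-P+\boldsymbol{\alpha}\boldsymbol{\beta}^T]^{-1}+\gamma\boldsymbol{e}\boldsymbol{\pi}^T$ with $\boldsymbol{\alpha},\boldsymbol{\beta}\in\mathbb{R}^m$, $\gamma\in\mathbb{R}$, $\boldsymbol{\pi}^T\boldsymbol{\alpha}=1$, $\boldsymbol{\beta}^T\boldsymbol{e}=1$; this is written $G=G(\boldsymbol{\alpha},\boldsymbol{\beta},\gamma)$. *)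

(* Defs.v *)
From HB Require Import structures.
From mathcomp Require Import all_boot all_order all_algebra.
From mathcomp Require Import all_classical all_reals all_analysis.

Set Implicit Arguments.
Unset Strict Implicit.
Unset Printing Implicit Defensive.

Import Order.TTheory GRing.Theory Num.Theory.
Import numFieldNormedType.Exports.

Local Open Scope classical_set_scope.
Local Open Scope ring_scope.

Section Matrices.
Context {R : realType} {m : nat}.
Implicit Types (P A X G : 'M[R]_m) (pi alpha beta : 'cV[R]_m) (gamma : R).

(* The all-ones column vector. *)
Definition onesv : 'cV[R]_m := const_mx 1.

Definition stochastic P : Prop :=
  (forall i j, 0 <= P i j) /\ P *m onesv = onesv.

Definition irreducible_chain P : Prop :=
  forall i j, exists n : nat, 0 < (P ^+ n) i j.

Definition stationary_prob P pi : Prop :=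
  [/\ forall i, 0 <= pi i 0, pi^T *m P = pi^T & pi^T *m onesv = 1%:M].

Definition moore_penrose A X : Prop :=
  [/\ A *m X *m A = A, X *m A *m X = X,
      (A *m X)^T = A *m X & (X *m A)^T = X *m A].

(* G = G(alpha, beta, gamma). The [unitmx] clause is needed because [invmx]
   returns its argument on singular matrices. *)
Definition ginv_param P pi G alpha beta gamma : Prop :=
  [/\ pi^T *m alpha = 1%:M, beta^T *m onesv = 1%:M,
      (1%:M - P + alpha *m beta^T) \in unitmx
    & G = invmx (1%:M - P + alpha *m beta^T) + gamma *: (onesv *m pi^T)].

End Matrices.

Section MarkovChains.
Context {R : realType} {m : nat} {d : measure_display} {Omega : measurableType d}.
Implicit Types (Pr : probability Omega R) (X : nat -> Omega -> 'I_m).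

Definition cond_prob Pr (A B : set Omega) : R :=
  fine (Pr (A `&` B)) / fine (Pr B).

Definition cond_expectation Pr (f : Omega -> \bar R) (B : set Omega) : \bar R :=
  ((\int[Pr]_(w in B) f w) * ((fine (Pr B))^-1)%:E)%E.

(* X is a time-homogeneous Markov chain with transition matrix P under Pr; its
   initial distribution is arbitrary. A history is a function x : nat -> 'I_m of
   which only the values at 0, ..., n are used. *)
Definition markov_chain Pr X (P : 'M[R]_m) : Prop :=
  (forall n i, measurable [set w | X n w = i]) /\
  (forall n (x : nat -> 'I_m) (j : 'I_m),
     let history := [set w | forall k, (k <= n)%N -> X k w = x k] in
     (0 < Pr history)%E ->
     cond_prob Pr [set w | X n.+1 w = j] history = P (x n) j).

(* min {n >= 1 : X_n = j}, equal to +oo when j is never reached. *)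
Definition first_passage_time X (j : 'I_m) (w : Omega) : \bar R :=
  ereal_inf [set n%:R%:E | n in [set n : nat | (1 <= n)%N /\ X n w = j]].

(* E[T_ij | X_0 = i]; meaningful when {X_0 = i} has positive probability. *)
Definition mean_first_passage_time Pr X (i j : 'I_m) : \bar R :=
  cond_expectation Pr (first_passage_time X j) [set w | X 0%N w = i].

End MarkovChains.

(* Main.v *)
(* The series over n of P(T_ij > n), which is E[T_ij], satisfies the first-step
   equation m_ij = 1 + sum_(k <> j) p_ik m_kj once it is known to converge.  For
   i = j the partial sums are at most 1 / pi_j by stationarity (Kac), and
   boundedness propagates along the positive transitions, hence to every state
   by irreducibility.
   Let N be (m_ij) with zero diagonal.  The first-step equation, multiplied on
   the left by pi^T, gives m_jj = 1 / pi_j, so that (I - P) N = E - diag(1 / pi_j),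
   where E = e e^T.
   The matrix H given by the claimed formula then satisfies
   (I - P) H = I - pi pi^T / s and e^T H = 0, which makes H + e pi^T the inverse
   of I - P + alpha beta^T for alpha = pi / s and beta = e / m.  That inverse
   being two-sided, also H (I - P) = I - E / m, and the four Penrose equations
   follow; G = H by uniqueness of the Moore-Penrose inverse. *)
Require Import Defs.
From HB Require Import structures.
From mathcomp Require Import all_boot all_order all_algebra.
From mathcomp Require Import all_classical all_reals all_analysis.
From mathcomp Require Import measurable_realfun.

Set Implicit Arguments.
Unset Strict Implicit.
Unset Printing Implicit Defensive.

Import Order.TTheory GRing.Theory Num.Theory.
Import numFieldNormedType.Exports.

Local Open Scope classical_set_scope.
Local Open Scope ring_scope.

(** * Positivity of the stationary vector *)

Lemma sum_dot_onesv (R : realType) (m : nat) (u : 'cV[R]_m) :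
  u^T *m onesv = 1%:M -> \sum_k u k 0 = 1.
Proof.
move/matrixP/(_ 0 0); rewrite [1%:M _ _]mxE mulr1n mxE => <-.
by apply: eq_bigr => k _; rewrite !mxE mulr1.
Qed.

Section StationaryVector.
Context {R : realType} {m : nat} (P : 'M[R]_m) (pi : 'cV[R]_m).
Hypotheses (hP : stochastic P) (hirr : irreducible_chain P).
Hypothesis hpi : stationary_prob P pi.

Lemma expmx_ge0 n i j : 0 <= (P ^+ n) i j.
Proof.
elim: n i j => [|n IH] i j; first by rewrite expr0 mxE ler0n.
by rewrite exprS mxE sumr_ge0 // => k _; rewrite mulr_ge0 //; case: hP.
Qed.

Lemma stationary_expmx n : pi^T *m (P ^+ n) = pi^T.
Proof.
elim: n => [|n IH]; first by rewrite expr0 mulmx1.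
by rewrite exprS mulmxA; case: hpi => _ -> _.
Qed.

(** Some state k carries positive mass because the total is 1, and irreducibility gives n with
    (P^n)_ki > 0; then pi_i = (pi^T P^n)_i >= pi_k (P^n)_ki > 0. *)
Lemma stationary_gt0 i : 0 < pi i 0.
Proof.
have [pi_ge0 _ pie] := hpi.
have [k pik] : exists k, 0 < pi k 0.
  apply/existsP; apply/negbNE/negP => /existsPn npos.
  have := sum_dot_onesv pie; rewrite big1 => [/eqP|k _].
    by rewrite eq_sym oner_eq0.
  by apply/eqP; rewrite eq_le pi_ge0 andbT leNgt npos.
have [n Pki] := hirr k i.
have /matrixP/(_ 0 i) := stationary_expmx n; rewrite !mxE => <-.
rewrite (bigD1 k) //= ltr_wpDr ?mxE ?mulr_gt0 //.
by rewrite sumr_ge0 // => l _; rewrite mxE mulr_ge0 // expmx_ge0.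
Qed.

Lemma stationary_fix k : \sum_i pi i 0 * P i k = pi k 0.
Proof.
have [_ /matrixP/(_ 0 k) + _] := hpi; rewrite !mxE => <-.
by apply: eq_bigr => i _; rewrite mxE.
Qed.

End StationaryVector.

(** * Passage times as convergent series of avoidance probabilities *)

Section PassageTimes.
Context {R : realType} {m : nat} (P : 'M[R]_m) (j : 'I_m).

(* [avoidance n i] is the probability that the chain started at i is not in j
   at any of the times 1, ..., n. *)
Fixpoint avoidance (n : nat) (i : 'I_m) : R :=
  if n is n'.+1 then \sum_(k | k != j) P i k * avoidance n' k else 1.

(** Tail-sum form of E[T_ij], since [avoidance n i] is P(T_ij > n). The limit carries this meaning
    only once [is_cvg_series_avoidance] is established. *)
Definition passage_time (i : 'I_m) : R :=
  limn (series (fun n => avoidance n i)).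

Lemma series_avoidanceS n i :
  series (fun n => avoidance n i) n.+1 =
  1 + \sum_(k | k != j) P i k * series (fun n => avoidance n k) n.
Proof.
rewrite /series /= big_nat_recl //=; congr (_ + _).
rewrite exchange_big /=; apply: eq_bigr => k _.
by rewrite mulr_sumr.
Qed.

Context (pi : 'cV[R]_m).
Hypotheses (hP : stochastic P) (hirr : irreducible_chain P).
Hypothesis hpi : stationary_prob P pi.

Lemma avoidance_ge0 n i : 0 <= avoidance n i.
Proof.
elim: n i => [|n IH] i //=; rewrite sumr_ge0 // => k _.
by rewrite mulr_ge0 //; case: hP.
Qed.

Lemma nondecreasing_series_avoidance i :
  nondecreasing_seq (series (fun n => avoidance n i)).
Proof.
by apply/nondecreasing_seqP => n; rewrite /series /= big_nat_recr //= lerDl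
  avoidance_ge0.
Qed.

Lemma series_avoidance_ge0 n i : 0 <= series (fun n => avoidance n i) n.
Proof. by rewrite /series /= sumr_ge0 // => k _; exact: avoidance_ge0. Qed.

(* Kac: with S(n, k) the sum over the first n times, stationarity turns the
   first-step recursion into
   pi S(n+1) = 1 + pi S(n) - pi_j S(n, j), and pi S is nondecreasing in n. *)
Lemma return_series_bound n : pi j 0 * series (fun n => avoidance n j) n <= 1.
Proof.
have [pi_ge0 _ pie] := hpi.
set S := fun n i => series (fun n => avoidance n i) n.
have step : \sum_i pi i 0 * S n.+1 i = 1 + \sum_(k | k != j) pi k 0 * S n k.
  rewrite -(sum_dot_onesv pie).
  under eq_bigr do rewrite /S series_avoidanceS mulrDr mulr1.
  rewrite big_split /=; congr (_ + _).
  under eq_bigr do rewrite mulr_sumr.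
  rewrite exchange_big /=; apply: eq_bigr => k _.
  rewrite -(stationary_fix hpi k) mulr_suml.
  by apply: eq_bigr => i _; rewrite mulrA.
have : \sum_i pi i 0 * S n i <= \sum_i pi i 0 * S n.+1 i.
  apply: ler_sum => i _; rewrite ler_wpM2l //.
  exact: nondecreasing_series_avoidance.
by rewrite step (bigD1 j) //= lerD2r.
Qed.

(** Induction on the length n of a path of positive probability from j to i. Kac's bound starts it
    at j; along a transition k to i with i != j, the recursion at k gives P_ki S(N, i) <= S(N+1,
    k). *)
Lemma series_avoidance_bound i :
  exists B, forall n, series (fun n => avoidance n i) n <= B.
Proof.
have [n] := hirr j i; elim: n i => [|n IH] i.
  rewrite expr0 mxE; case: eqVneq => [<- _|]; last by rewrite ltxx.
  exists (pi j 0)^-1 => n.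
  rewrite -[leRHS]mulr1 ler_pdivlMl ?return_series_bound //.
  exact: stationary_gt0 hpi _.
rewrite exprSr mxE => Pji.
(* A positive sum of nonnegative terms has a positive term: k is the last state before i on the
   path. *)
have [k] : exists k, 0 < (P ^+ n) j k * P k i.
  apply/existsP; apply/negbNE/negP => /existsPn npos.
  move: Pji; rewrite lt_neqAle eq_sym => /andP[/eqP + _]; apply.
  apply: big1 => k _; apply/eqP; rewrite eq_le leNgt npos /=.
  by rewrite mulr_ge0 ?expmx_ge0 //; case: hP.
have [P_ge0 _] := hP.
move=> Pjki; have Pjk : 0 < (P ^+ n) j k.
  rewrite lt_neqAle expmx_ge0 // andbT eq_sym.
  by apply: contraTneq Pjki => ->; rewrite mul0r ltxx.
have Pki : 0 < P k i by move: Pjki; rewrite pmulr_rgt0.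
(* The recursion at k omits the state j, so a return to j calls for Kac's bound again. *)
have [->|ij] := eqVneq i j.
  exists (pi j 0)^-1 => N.
  rewrite -[leRHS]mulr1 ler_pdivlMl ?return_series_bound //.
  exact: stationary_gt0 hpi _.
have [B SB] := IH k Pjk.
exists ((P k i)^-1 * B) => N; rewrite ler_pdivlMl //.
apply: le_trans (SB N.+1).
rewrite series_avoidanceS (bigD1 i) //= addrCA lerDl addr_ge0 //.
by rewrite sumr_ge0 // => l _; rewrite mulr_ge0 // series_avoidance_ge0.
Qed.

Lemma is_cvg_series_avoidance i : cvgn (series (fun n => avoidance n i)).
Proof.
apply: nondecreasing_is_cvgn; first exact: nondecreasing_series_avoidance.
have [B SB] := series_avoidance_bound i.
by exists B => _ [n _ <-].
Qed.

(** Limit of [series_avoidanceS] as n grows; convergence at every state lets the limit pass through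
    the finite sum. *)
Lemma passage_time_first_step i :
  passage_time i = 1 + \sum_(k | k != j) P i k * passage_time k.
Proof.
apply: cvg_lim => //; rewrite -(cvg_shiftn 1) /=.
under eq_fun do rewrite addn1 series_avoidanceS.
apply: cvgD; first exact: cvg_cst.
apply: cvg_big => [|k _]; first exact: add_continuous.
apply: cvgM; [exact: cvg_cst | exact: is_cvg_series_avoidance].
Qed.

End PassageTimes.

(** * From path probabilities to mean first passage times *)

Section PathLaw.
Context {R : realType} {m : nat} {d : measure_display}.
Context {Omega : measurableType d} (Pr : probability Omega R).
Context (X : nat -> Omega -> 'I_m) (P : 'M[R]_m).
Hypothesis hX : markov_chain Pr X P.

Definition history (n : nat) (x : nat -> 'I_m) : set Omega :=
  [set w | forall k, (k <= n)%N -> X k w = x k].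

Definition avoid_event (j : 'I_m) (n q : nat) : set Omega :=
  [set w | forall t, (n < t <= n + q)%N -> X t w != j].

Lemma measurable_state n i : measurable [set w | X n w = i].
Proof. by case: hX. Qed.

Lemma measurable_history n x : measurable (history n x).
Proof.
rewrite (_ : history n x =
  \bigcap_(k in [set k | (k <= n)%N]) [set w | X k w = x k]) //.
by apply: bigcap_measurableType => k _; exact: measurable_state.
Qed.

Lemma measurable_avoid_event j n q : measurable (avoid_event j n q).
Proof.
rewrite (_ : avoid_event j n q =
  \bigcap_(t in [set t | (n < t <= n + q)%N]) ~` [set w | X t w = j]).
  apply: bigcap_measurableType => t _; apply: measurableC.
  exact: measurable_state.
by apply/seteqP; split => w /= h t /h => [/eqP|] // /eqP.
Qed.

Lemma probability_state_partition n (E : set Omega) : measurable E ->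
  Pr E = (\sum_(l < m) Pr (E `&` [set w | X n w = l]))%E.
Proof.
move=> mE; rewrite -(measure_bigsetU_ord Pr xpredT) /=.
- congr (Pr _); apply/seteqP; split => w.
    by move=> Ew; rewrite (bigD1 (X n w)) //=; left.
  by elim/big_ind: _ => // [A B AE BE [/AE|/BE] //|l _ []].
- by move=> l; apply: measurableI => //; exact: measurable_state.
- by apply/trivIsetP => k l _ _; apply: contraNeq => /set0P[w [[_ <-] [_ <-]]].
Qed.

(** The Markov property speaks only of histories of positive probability; for a null history both
    sides vanish. *)
Lemma probability_history_step n x l :
  Pr (history n x `&` [set w | X n.+1 w = l]) =
  (Pr (history n x) * (P (x n) l)%:E)%E.
Proof.
have mH := measurable_history n x; have mS := measurable_state n.+1 l.
have [H_gt0|H_le0] := ltP 0%E (Pr (history n x)).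
  have [_ /(_ n x l H_gt0)] := hX; rewrite /cond_prob -/(history n x) => <-.
  have Hfin := fin_num_measure Pr _ mH.
  rewrite -{1}(fineK Hfin) -EFinM mulrCA divff ?mulr1.
    rewrite setIC fineK // fin_num_measure //.
    exact: measurableI.
  by rewrite fine_eq0 // gt_eqF.
have H0 : Pr (history n x) = 0%E by apply/eqP; rewrite eq_le H_le0 measure_ge0.
rewrite H0 mul0e; apply: (subset_measure0 _ mH) => //.
exact: measurableI.
Qed.

(** Induction on q, for all n and x, splitting on the state l at time n+1: l = j is ruled out by
    avoidance, and any other l extends the history by one step. *)
Lemma probability_history_avoid j q n x :
  Pr (history n x `&` avoid_event j n q) =
  (Pr (history n x) * (avoidance P j q (x n))%:E)%E.
Proof.
elim: q n x => [|q IH] n x.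
  rewrite mule1; congr (Pr _); apply/setIidPl => w _ t.
  by rewrite addn0 => /andP[/leq_trans h /h]; rewrite ltnn.
rewrite (probability_state_partition n.+1); last first.
  by apply: measurableI; [exact: measurable_history | exact: measurable_avoid_event].
rewrite (bigD1 j) //= (_ : _ `&` _ = set0) ?measure0 ?add0e; last first.
  apply/seteqP; split => // w [[_ /(_ n.+1)] /[swap]] /= ->.
  by rewrite eqxx ltnSn -addSnnS leq_addr => /(_ isT).
have Hfin := fin_num_measure Pr _ (measurable_history n x).
rewrite -(fineK Hfin) -EFinM mulr_sumr -sumEFin.
apply: eq_bigr => l lj.
pose y t := if t == n.+1 then l else x t.
have Hy : history n x `&` [set w | X n.+1 w = l] = history n.+1 y.
  apply/seteqP; split => w.
    move=> [Hw Xw] k; rewrite leq_eqVlt /y; case: eqP => [-> //|_ /= kn].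
    exact: Hw.
  move=> Hw; split => [k kn|]; rewrite /= Hw // /y ?eqxx //.
    by rewrite ltn_eqF.
  exact: leqW.
rewrite !EFinM muleA (fineK Hfin) -probability_history_step Hy.
have yl : y n.+1 = l by rewrite /y eqxx.
have := IH n.+1 y; rewrite yl => <-; rewrite -Hy.
congr (Pr _); apply/seteqP; split => w.
  move=> [[Hw Aw] Xw]; split => // t /andP[nt tq]; apply: Aw.
  by rewrite (ltnW nt) -addSnnS.
move=> [[Hw Xw] Aw]; split => //; split => // t /andP[nt tq].
move: nt; rewrite leq_eqVlt => /orP[/eqP <-|nt]; first by rewrite Xw.
by apply: Aw; rewrite nt addSnnS.
Qed.

(** T is the sum over n >= 0 of the indicators of T > n. If j is first reached at N, exactly the
    terms n < N equal 1; if never, all terms are 1 and both sides are infinite. *)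
Lemma first_passage_timeE j w :
  first_passage_time X j w =
  (\sum_(0 <= n <oo) (\1_(avoid_event j 0 n) w : R)%:E)%E.
Proof.
set f := fun n => (\1_(avoid_event j 0 n) w : R)%:E.
have f_ge0 n : (0 <= f n)%E by rewrite lee_fin.
have [ex|nex] := pselect (exists n, (0 < n)%N && (X n w == j)).
  case: (ex_minnP ex) => N /andP[N_gt0 /eqP XN] Nmin.
  rewrite (nneseries_split _ N) // add0n eseries0 ?adde0; last first.
    move=> n Nn _; rewrite /f indicE memNset // => /(_ N).
    by rewrite add0n N_gt0 Nn XN eqxx => /(_ isT).
  rewrite (eq_big_nat _ _ (F2 := fun=> 1%E)); last first.
    move=> n /andP[_ nN]; rewrite /f indicE mem_set // => t /andP[t_gt0 tn].
    apply/negP => Xt; have := Nmin t; rewrite t_gt0 Xt => /(_ isT).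
    by rewrite leqNgt (leq_ltn_trans tn).
  rewrite sumEFin sumr_const_nat subn0.
  apply/eqP; rewrite eq_le; apply/andP; split.
    by apply: ereal_inf_lbound; exists N.
  apply: le_ereal_inf_tmp => _ [n [n_gt0 Xn] <-].
  by rewrite lee_fin ler_nat Nmin // n_gt0 Xn eqxx.
rewrite /first_passage_time (_ : [set _ | _ in _] = set0); last first.
  apply/seteqP; split => // z [n [n_gt0 Xn] _]; apply: nex.
  by exists n; rewrite n_gt0 Xn eqxx.
rewrite ereal_inf0; apply/esym/eqyP => A A_gt0.
(* By the Archimedean property, the first [Num.bound A] terms, all equal to 1, already sum to at
   least A. *)
apply: le_trans (nneseries_lim_ge (Num.bound A) _); last by [].
rewrite (eq_big_nat _ _ (F2 := fun=> 1%E)); last first.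
  move=> n _; rewrite /f indicE mem_set // => t /andP[t_gt0 _].
  by apply/negP => Xt; apply: nex; exists t; rewrite t_gt0.
rewrite sumEFin sumr_const_nat subn0 lee_fin ltW //.
exact: archi_boundP (ltW A_gt0).
Qed.

(** Integrating the indicator series term by term gives Pr(X_0 = i) times the avoidance series, and
    the conditioning divides that factor out. *)
Lemma mean_first_passage_timeE (pi : 'cV[R]_m) i j :
  stochastic P -> irreducible_chain P -> stationary_prob P pi ->
  (0 < Pr [set w | X 0%N w = i])%E ->
  fine (mean_first_passage_time Pr X i j) = passage_time P j i.
Proof.
move=> hP hirr hpi X0_gt0.
have mX0 := measurable_state 0 i.
have X0E : [set w | X 0%N w = i] = history 0 (fun=> i).
  apply/seteqP; split => w; first by move=> <- [|k].
  by apply.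
rewrite /mean_first_passage_time /cond_expectation.
under eq_integral do rewrite first_passage_timeE.
rewrite integral_nneseries //; last first.
  move=> n; apply/measurable_EFinP/measurable_indic.
  exact: measurable_avoid_event.
rewrite (eq_eseriesr (g := fun n =>
    (Pr [set w | X 0%N w = i] * (avoidance P j n i)%:E)%E)); last first.
  move=> n _; rewrite integral_indic //; last exact: measurable_avoid_event.
  rewrite setIC X0E; exact: probability_history_avoid.
have Xfin := fin_num_measure Pr _ mX0.
have a_neq0 : fine (Pr [set w | X 0%N w = i]) != 0 by rewrite fine_eq0 // gt_eqF.
rewrite -{1}(fineK Xfin) nneseriesZl; last first.
  by move=> n _; rewrite lee_fin (avoidance_ge0 j hP).
rewrite (_ : (\sum_(0 <= n <oo) _)%E = (passage_time P j i)%:E).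
  by rewrite -!EFinM /= mulrC mulKf.
(* Convergence of the real series makes the extended sum finite, so [fine] loses nothing. *)
rewrite -(EFin_lim (is_cvg_series_avoidance (j := j) (i := i) hP hirr hpi)).
by congr (limn _); apply/funext => n /=; rewrite sumEFin.
Qed.

End PathLaw.

(** * Uniqueness of the Moore-Penrose inverse *)

(** AG = (AH)(AG) is a product of symmetric matrices, so transposing gives AG = (AG)(AH) = AH.
    Likewise GA = HA, whence G = GAG = HAH = H. *)
Lemma moore_penrose_uniq (R : realType) (m : nat) (A G H : 'M[R]_m) :
  moore_penrose A G -> moore_penrose A H -> G = H.
Proof.
move=> [G1 G2 G3 G4] [H1 H2 H3 H4].
have AGH : A *m G = A *m H.
  have e1 : A *m G = A *m H *m (A *m G) by rewrite mulmxA H1.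
  by rewrite -G3 e1 trmx_mul G3 H3 mulmxA G1.
have GAH : G *m A = H *m A.
  have e1 : G *m A = G *m A *m (H *m A) by rewrite -mulmxA (mulmxA A) H1.
  by rewrite -G4 e1 trmx_mul G4 H4 -mulmxA (mulmxA A) G1.
by rewrite -G2 GAH -mulmxA AGH mulmxA.
Qed.

(** * The closed-form g-inverse built from passage times *)

(* In this section [N] stands for the matrix of mean first passage times with
   its diagonal replaced by 0. *)
Section InverseFromPassageTimes.
Context {R : realType} {m : nat} (P N : 'M[R]_m) (pi : 'cV[R]_m).
Hypothesis Pe : P *m onesv = onesv.
Hypothesis pi_gt0 : forall i, 0 < pi i 0.
Hypothesis piP : pi^T *m P = pi^T.
Hypothesis pie : pi^T *m onesv = 1%:M.
Hypothesis PN : (1%:M - P) *m N = const_mx 1 - diag_mx (\row_j (pi j 0)^-1).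

Let e : 'cV[R]_m := onesv.
Let s : R := \sum_k pi k 0 ^+ 2.
Let sq : 'cV[R]_m := \col_k pi k 0 ^+ 2.
Let eta : 'rV[R]_m := m%:R^-1 *: (e^T *m N).
Let c : 'cV[R]_m := s^-1 *: (N *m sq).
Let K : R := s^-1 * (eta *m sq) 0 0.

(** Its entries are (eta_j - N_ij + c_i - K) pi_j; the zero diagonal of [N] merges the two cases of
    the claimed formula. *)
Definition passage_ginv : 'M[R]_m :=
  (e *m eta - N + c *m e^T - K *: (e *m e^T)) *m diag_mx pi^T.

Let alpha : 'cV[R]_m := ((pi^T *m pi) 0 0)^-1 *: pi.
Let beta : 'cV[R]_m := m%:R^-1 *: e.

Lemma states_neq0 : m%:R != 0 :> R.
Proof.
rewrite pnatr_eq0; apply/eqP => m0; have := sum_dot_onesv pie.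
rewrite big1 => [/eqP|k _]; first by rewrite eq_sym oner_eq0.
by have := ltn_ord k; rewrite [X in (_ < X)%N]m0.
Qed.

Lemma pipi_sum : pi^T *m pi = s%:M.
Proof.
apply/matrixP => i j; rewrite !mxE !ord1 /= mulr1n.
by apply: eq_bigr => k _; rewrite !mxE expr2.
Qed.

Lemma sum_sqr_neq0 : s != 0.
Proof.
rewrite /s psumr_neq0; last by move=> k _; rewrite sqr_ge0.
have m_gt0 : (0 < m)%N by rewrite lt0n -(pnatr_eq0 R) states_neq0.
apply/hasP; exists (Ordinal m_gt0); first exact: mem_index_enum.
by rewrite exprn_gt0.
Qed.

Lemma ete : e^T *m e = m%:R%:M.
Proof.
apply/matrixP => i j; rewrite !mxE !ord1 /= mulr1n.
under eq_bigr do rewrite !mxE mulr1.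
by rewrite sumr_const card_ord.
Qed.

Lemma oneB_onesv : (1%:M - P) *m e = 0.
Proof. by rewrite mulmxBl mul1mx Pe subrr. Qed.

Lemma diag_pi : e^T *m diag_mx pi^T = pi^T.
Proof.
by apply/matrixP => i j; rewrite mul_mx_diag !mxE mul1r !ord1.
Qed.

(** I - P kills e, hence the [eta] and [K] terms; [PN] handles [N] and [c], and the two copies of e
    e^T cancel. *)
Lemma oneB_passage_ginv :
  (1%:M - P) *m passage_ginv = 1%:M - s^-1 *: (pi *m pi^T).
Proof.
(* From [PN]: (I - P) N sq = (E - diag(1 / pi_j)) sq = s e - pi. *)
have Ac : (1%:M - P) *m c = e - s^-1 *: pi.
  rewrite /c -scalemxAr mulmxA PN mulmxBl.
  have -> : const_mx 1 *m sq = s *: e.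
    apply/matrixP => i j; rewrite !mxE mulr1.
    by apply: eq_bigr => k _; rewrite !mxE mul1r.
  have -> : diag_mx (\row_j (pi j 0)^-1) *m sq = pi.
    apply/matrixP => i j; rewrite mul_diag_mx !mxE expr2 mulKf ?gt_eqF//.
    by rewrite ord1.
  by rewrite scalerBr scalerA mulVf ?scale1r// sum_sqr_neq0.
have -> : (1%:M - P) *m passage_ginv =
    ((e - s^-1 *: pi) *m e^T - (const_mx 1 - diag_mx (\row_j (pi j 0)^-1)))
      *m diag_mx pi^T.
  rewrite /passage_ginv mulmxA; congr (_ *m _).
  rewrite mulmxBr mulmxDr mulmxBr PN (mulmxA _ e eta) oneB_onesv mul0mx.
  rewrite (mulmxA _ c) Ac -(scalemxAr K) (mulmxA _ e) oneB_onesv mul0mx.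
  by rewrite scaler0 subr0 sub0r addrC.
have -> : const_mx 1 = e *m e^T.
  by apply/matrixP => i j; rewrite !mxE big_ord1 !mxE mulr1.
rewrite mulmxBl (mulmxBl (e *m e^T)) -!(mulmxA _ e^T) diag_pi.
rewrite mulmxBl -(scalemxAl _ pi).
have -> : diag_mx (\row_j (pi j 0)^-1) *m diag_mx pi^T = 1%:M.
  apply/matrixP => i j; rewrite mul_diag_mx !mxE.
  by case: eqVneq => [->|]; rewrite ?mulr0 // mulr1n mulVf ?gt_eqF.
by rewrite opprB addrC addrA subrK.
Qed.

(** Since e^T e = m, the factor 1/m in [eta] makes e^T e eta cancel e^T N, and [K] is the mean of
    the entries of [c], so those terms cancel too. *)
Lemma onesv_passage_ginv : e^T *m passage_ginv = 0.
Proof.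
have m0 := states_neq0.
suff h : e^T *m (e *m eta - N + c *m e^T - K *: (e *m e^T)) = 0.
  by rewrite /passage_ginv mulmxA h mul0mx.
rewrite mulmxBr mulmxDr mulmxBr (mulmxA _ e eta) ete mul_scalar_mx.
rewrite {1}/eta scalerA mulfV// scale1r subrr add0r.
rewrite -(scalemxAr K) (mulmxA _ e) ete (mulmxA _ c).
have -> : e^T *m c = (m%:R * K)%:M.
  rewrite /c -scalemxAr /K /eta -scalemxAl mulmxA.
  apply/matrixP => i j; rewrite !ord1 [RHS]mxE mulr1n [LHS]mxE.
  by rewrite [X in _ = _ * (_ * X)]mxE mulrCA mulVKf.
by rewrite !mul_scalar_mx scalerA mulrC subrr.
Qed.

Lemma uniform_onesv : beta^T *m e = 1%:M.
Proof.
rewrite linearZ /= -(scalemxAl _ e^T) ete scale_scalar_mx mulVf//.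
exact: states_neq0.
Qed.

Lemma passage_ginv_inverse :
  (1%:M - P + alpha *m beta^T) *m (passage_ginv + e *m pi^T) = 1%:M.
Proof.
have bH : beta^T *m passage_ginv = 0.
  by rewrite linearZ /= -(scalemxAl _ e^T) onesv_passage_ginv scaler0.
rewrite mulmxDl !mulmxDr mulmxA oneB_onesv mul0mx addr0 oneB_passage_ginv.
rewrite -(mulmxA alpha) bH mulmx0 add0r -(mulmxA alpha) (mulmxA _ e).
rewrite uniform_onesv mul1mx -(scalemxAl _ pi) pipi_sum [_%:M 0 0]mxE /= mulr1n.
by rewrite subrK.
Qed.

Lemma passage_ginv_param :
  ginv_param P pi passage_ginv alpha beta (-1).
Proof.
have BH := passage_ginv_inverse.
have [Bu Hu] := mulmx1_unit BH.
split => //.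
- rewrite /alpha -scalemxAr pipi_sum [_%:M 0 0]mxE /= mulr1n.
  by rewrite scale_scalar_mx mulVf// sum_sqr_neq0.
- exact: uniform_onesv.
- rewrite -[LHS](addrK (e *m pi^T)) -[_ + e *m _](mulKmx Bu) BH mulmx1.
  by rewrite scaleN1r.
Qed.

(** With A = I - P, both AH = I - pi pi^T / s and HA = I - E / m are symmetric; AHA = A follows from
    pi^T A = 0, and HAH = H from e^T H = 0. *)
Lemma passage_ginv_moore_penrose : moore_penrose (1%:M - P) passage_ginv.
Proof.
have BH := passage_ginv_inverse.
have HB := mulmx1C BH.
have bT : beta^T = m%:R^-1 *: e^T by rewrite linearZ.
have Be : (1%:M - P + alpha *m beta^T) *m e = alpha.
  by rewrite mulmxDl oneB_onesv add0r -(mulmxA alpha) uniform_onesv mulmx1.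
(* The matrix I - P + alpha beta^T sends e to alpha, so its inverse H + e pi^T sends alpha to e; as
   pi^T alpha = 1, nothing is left for H alpha. *)
have Ha : passage_ginv *m alpha = 0.
  have : (passage_ginv + e *m pi^T) *m alpha = e by rewrite -{1}Be mulmxA HB mul1mx.
  have pa : pi^T *m alpha = 1%:M by case: passage_ginv_param.
  by rewrite mulmxDl -mulmxA pa mulmx1 => /(canRL (addrK _)); rewrite subrr.
have piA : pi^T *m (1%:M - P) = 0 by rewrite mulmxBr piP mulmx1 subrr.
have HA : passage_ginv *m (1%:M - P) = 1%:M - m%:R^-1 *: (e *m e^T).
  move: HB; rewrite mulmxDl (mulmxDr passage_ginv (1%:M - P)) (mulmxDr (e *m pi^T)).
  rewrite (mulmxA passage_ginv) Ha mul0mx addr0.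
  have pa : pi^T *m alpha = 1%:M by case: passage_ginv_param.
  rewrite -(mulmxA e pi^T) piA mulmx0 add0r -(mulmxA e pi^T).
  rewrite (mulmxA pi^T alpha) pa mul1mx bT -scalemxAr.
  exact: (canRL (addrK _)).
split.
- by rewrite oneB_passage_ginv mulmxBl mul1mx -scalemxAl -mulmxA piA mulmx0
    scaler0 subr0.
- by rewrite HA mulmxBl mul1mx -scalemxAl -mulmxA onesv_passage_ginv mulmx0
    scaler0 subr0.
- by rewrite oneB_passage_ginv linearB linearZ /= trmx_mul trmxK trmx1.
- by rewrite HA linearB linearZ /= trmx_mul trmxK trmx1.
Qed.

End InverseFromPassageTimes.

(** * Matching the closed form with the claimed entries *)

(* [Pr] is indexed by the starting state so as to cover both a single chain whose
   initial distribution charges every state (constant family) and the usual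
   family of laws of the chain started at i; m_ij conditions on X_0 = i. *)
Theorem corollary11p9 (R : realType) (m : nat) (P : 'M[R]_m) (pi : 'cV[R]_m)
    (d : measure_display) (Omega : measurableType d)
    (Pr : 'I_m -> probability Omega R) (X : nat -> Omega -> 'I_m)
    (G : 'M[R]_m)
    (hP : stochastic P) (hirr : irreducible_chain P)
    (hpi : stationary_prob P pi)
    (hX : forall i, markov_chain (Pr i) X P)
    (hX0 : forall i, (0 < Pr i [set w | X 0%N w = i])%E)
    (hG : moore_penrose (1%:M - P) G) :
  let M := fun i j : 'I_m => fine (mean_first_passage_time (Pr i) X i j) in
  let eta := fun j : 'I_m => m%:R^-1 * \sum_(k | k != j) M k j in
  let s := \sum_k pi k 0 ^+ 2 in
  ginv_param P pi G (((pi^T *m pi) 0 0)^-1 *: pi) (m%:R^-1 *: onesv) (-1) /\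
  forall i j : 'I_m,
    G i j =
      if i != j then
        (eta j - M i j + s^-1 * (\sum_(k | k != i) pi k 0 ^+ 2 * M i k)
           - s^-1 * (\sum_k pi k 0 ^+ 2 * eta k)) * pi j 0
      else
        (eta j + s^-1 * (\sum_(k | k != j) pi k 0 ^+ 2 * M j k)
           - s^-1 * (\sum_k pi k 0 ^+ 2 * eta k)) * pi j 0.
Proof.
move=> M eta s.
have [_ Pe] := hP; have [_ piP pie] := hpi.
have pi_gt0 := stationary_gt0 hP hirr hpi.
have MS i k : M i k = 1 + \sum_(l | l != k) P i l * M l k.
  have ME i' : M i' k = passage_time P k i'.
    exact: mean_first_passage_timeE hP hirr hpi (hX0 i').
  rewrite ME (passage_time_first_step k hP hirr hpi); congr (_ + _).
  by apply: eq_bigr => l _; rewrite ME.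
(* The zero diagonal turns the sum over l != k in the first-step equation into a full matrix
   product. *)
pose N : 'M[R]_m := \matrix_(i, k) (if i == k then 0 else M i k).
have PNE i k : ((1%:M - P) *m N) i k = N i k + 1 - M i k.
  rewrite mulmxBl mul1mx [LHS]mxE -addrA; congr (_ + _); rewrite mxE.
  rewrite MS opprD addrA subrr add0r mxE; congr (- _).
  rewrite [RHS]big_mkcond; apply: eq_bigr => l _; rewrite mxE.
  by case: eqVneq => //= _; rewrite mulr0.
(* Column k of (I - P) N is 1 off the diagonal and 1 - m_kk on it; pi^T annihilates it, so 1 - pi_k
   m_kk = 0. *)
have kac k : M k k = (pi k 0)^-1.
  have /matrixP/(_ 0 k) : pi^T *m ((1%:M - P) *m N) = 0.
    by rewrite mulmxA mulmxBr mulmx1 piP subrr mul0mx.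
  rewrite [RHS]mxE mxE (bigD1 k) //= PNE [N k k]mxE eqxx add0r.
  rewrite (eq_bigr (fun l => pi l 0)) => [|l lk]; last first.
    by rewrite mxE PNE [N l k]mxE (negPf lk) addrAC subrr add0r mulr1.
  rewrite mxE mulrBr mulr1 addrAC -(bigD1 k (P := xpredT)) //=.
  rewrite (sum_dot_onesv pie) => /eqP; rewrite subr_eq0 => /eqP piM.
  by rewrite -[LHS](mulKf (lt0r_neq0 (pi_gt0 k))) -piM mulr1.
have PN : (1%:M - P) *m N = const_mx 1 - diag_mx (\row_k (pi k 0)^-1).
  apply/matrixP => i k; rewrite PNE !mxE.
  case: eqVneq => [->|_]; first by rewrite add0r kac mulr1n.
  by rewrite mulr0n subr0 addrAC subrr add0r.
have GE : G = passage_ginv N pi.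
  apply: moore_penrose_uniq hG _.
  exact: passage_ginv_moore_penrose Pe pi_gt0 piP pie PN.
split; first by rewrite GE; exact: passage_ginv_param.
have etaE k : (m%:R^-1 *: (onesv^T *m N)) 0 k = eta k.
  rewrite !mxE /eta; congr (_ * _); rewrite [RHS]big_mkcond.
  by apply: eq_bigr => l _; rewrite !mxE mul1r; case: eqVneq.
have cE i : (N *m (\col_k pi k 0 ^+ 2)) i 0 =
    \sum_(k | k != i) pi k 0 ^+ 2 * M i k.
  rewrite mxE [RHS]big_mkcond; apply: eq_bigr => k _; rewrite !mxE eq_sym.
  by case: eqVneq; rewrite ?mul0r // mulrC.
have KE : (m%:R^-1 *: (onesv^T *m N) *m \col_k pi k 0 ^+ 2) 0 0 =
    \sum_k pi k 0 ^+ 2 * eta k.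
  by rewrite mxE; apply: eq_bigr => k _; rewrite etaE mxE mulrC.
move=> i k; rewrite GE /passage_ginv mul_mx_diag mxE [pi^T 0 k]mxE KE -/s.
have -> : (onesv *m (m%:R^-1 *: (onesv^T *m N)) - N +
    s^-1 *: (N *m \col_k pi k 0 ^+ 2) *m onesv^T -
    (s^-1 * \sum_k pi k 0 ^+ 2 * eta k) *: (onesv *m onesv^T)) i k =
  eta k - N i k + s^-1 * (\sum_(k | k != i) pi k 0 ^+ 2 * M i k)
    - s^-1 * \sum_k pi k 0 ^+ 2 * eta k.
  (* Generalizing over the row and the column keeps [mxE] from unfolding them. *)
  rewrite -cE -etaE; move: (m%:R^-1 *: _) (N *m _) => u v.
  by rewrite !mxE !big_ord1 !mxE !mul1r !mulr1.
by rewrite mxE; case: eqVneq => [->|_] //=; rewrite subr0.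
Qed.
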